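(* Let $C$ be a Kummer cover of degree $n$ over $k$, presented by $y^n=f=u\prod_{j=1}^{n-1}f_j^j$ with associated integers $m_i$ (all as specified in the context). Then: (1) $$H^1(C,\mathcal{O}_C)=\sum_{i=1}^{n-1}\ \sum_{t=1}^{m_i-1}\frac{y^i}{\prod_{j=1}^{n-1}f_j^{\lfloor ji/n\rfloor}}\cdot\frac{1}{x^t}\cdot k.$$ (2) The genus of $C$ is $g(C)=\left(\sum_{i=1}^{n-1}m_i\right)-n+1$. Moreover, $$0\le g(C)\le\frac12(n-1)(\deg(f)-1).$$ (3) Let $\operatorname{char}(k)=p>0$. The induced Frobenius map $F$ on $H^1(C,\mathcal{O}_C)$ is determined by $$\frac{y^i}{\prod_{j=1}^{n-1}f_j^{\lfloor ji/n\rfloor}}\cdot\frac{1}{x^t}\ \longmapsto\ \sum_{w=1}^{m_{(pi\bmod n)}-1}c_w\cdot\frac{y^{(pi\bmod n)}}{\prod_{j=1}^{n-1}f_j^{\lfloor j\cdot(pi\bmod n)/n\rfloor}}\cdot\frac{1}{x^w},$$ where $c_w$ is the coefficient of $x^{pt-w}$ in $f^{\lfloor pi/n\rfloor}\big/\prod_{j=1}^{n-1}f_j^{\,p\lfloor ji/n\rfloor-\lfloor j\cdot(pi\bmod n)/n\rfloor}$.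
   Context: A Kummer cover of degree $n$ over a field $k$ is an irreducible projective smooth curve $C$ over $k$ for which there exists a finite separable morphism $\psi:C\to\mathbb{P}^1_k$ of degree $n$ such that the function field extension $K(C)/K(\mathbb{P}^1_k)$ is a Kummer extension; this includes that $\operatorname{char}(k)$ does not divide $n$ and that $k$ contains the $n$th roots of unity. Notation: $K(\mathbb{P}^1_k)=k(x)$, and $y$ is a generator of the cyclic extension $K(C)/k(x)$ with $y^n=f=u\prod_{j=1}^{n-1}f_j^j$, where $u\in k^*$, the $f_j\in k[x]$ are separable, the product is the square-free factorization of $f$ (so the $f_j$ are pairwise coprime), and $Z^n-f\in k(x)[Z]$ is irreducible. (Such a presentation exists after an extension of the original base field; $k$ denotes the extended field.) For each $i$ with $0\le i\le n-1$, $$m_i=\lceil i\deg(f)/n\rceil-\sum_{j=1}^{n-1}\deg(f_j)\lfloor ji/n\rfloor.$$ The curve $C$ is covered by the affine opens $U'=\psi^{-1}(\operatorname{Spec}k[x])=\operatorname{Spec}A$ and $V'=\psi^{-1}(\operatorname{Spec}k[1/x])=\operatorname{Spec}B$, where $$A=\sum_{i=0}^{n-1}\frac{y^i}{\prod_{j=1}^{n-1}f_j^{\lfloor ji/n\rfloor}}\cdot k[x],\qquad B=\sum_{i=0}^{n-1}\frac{y^i}{\prod_{j=1}^{n-1}f_j^{\lfloor ji/n\rfloor}}\cdot\frac{1}{x^{m_i}}\cdot k[1/x].$$ $H^1(C,\mathcal{O}_C)$ is computed as the cokernel of the Čech map $A\oplus B\to\Gamma(U'\cap V',\mathcal{O}_C)$,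 and elements of $\Gamma(U'\cap V',\mathcal{O}_C)\subset K(C)$ stand for their classes. $F$ is the $p$-semilinear map on $H^1(C,\mathcal{O}_C)$ induced by the absolute Frobenius of $C$. Here $pi\bmod n$ denotes the representative in $\{0,\dots,n-1\}$; an empty sum is $0$.
   Formalization: Part (2) is proved under the added assumption that k is algebraically closed in K(C) (C geometrically irreducible); without it the genus claim fails, e.g. y^2=2 over Q gives m_1=0 and g=-1. *)

(* Defs.v *)
From HB Require Import structures.
From mathcomp Require Import all_boot all_order all_algebra all_field.
From mathcomp Require Import boolp.

Set Implicit Arguments.
Unset Strict Implicit.
Unset Printing Implicit Defensive.

Import GRing.Theory Num.Theory Order.TTheory.
Local Open Scope ring_scope.
Local Open Scope quotient_scope.

Notation "q %:F" := (tofrac q) : ring_scope.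

(* Over a field k, a finite cover psi : C -> P^1_k by a normal curve is encoded
   by the finite extension K = K(C) of k(x) = {fraction {poly k}}.  Since psi is
   finite and C is normal, the ring of functions on psi^-1(W), for W an affine
   open of P^1_k, is the integral closure of O(W) in K. *)
Section CoverOfTheLine.
Variables (k : fieldType) (K : fieldExtType {fraction {poly k}}).

(* q |-> q(x) and q |-> q(1/x), with values in K *)
Definition polyK (q : {poly k}) : K := (q%:F)%:A.
Definition cstK (c : k) : K := polyK c%:P.
Definition polyVK (q : {poly k}) : K := (map_poly cstK q).[(polyK 'X)^-1].

HB.instance Definition _ := GRing.RMorphism.copy polyK
  (GRing.in_alg K \o @tofrac {poly k}).
HB.instance Definition _ := GRing.RMorphism.copy cstK (polyK \o polyC).
HB.instance Definition _ := GRing.RMorphism.copy polyVK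
  (horner_eval (polyK 'X)^-1 \o map_poly cstK).

Lemma polyK_eq0 q : (polyK q == 0) = (q == 0).
Proof. by rewrite /polyK -[_%:A]/(in_alg K _) fmorph_eq0 tofrac_eq0. Qed.

Lemma polyKX_neq0 : polyK 'X != 0.
Proof. by rewrite polyK_eq0 polyX_eq0. Qed.

(* Gamma(psi^-1(Spec k[x]), O_C) and Gamma(psi^-1(Spec k[1/x]), O_C) *)
Definition ringA (z : K) : Prop := integralOver polyK z.
Definition ringB (z : K) : Prop := integralOver polyVK z.

(* U' /\ V' is the principal open subset of Spec A where x is invertible. *)
Definition overlap : {pred K} :=
  [pred z | `[< exists m, ringA (polyK 'X ^+ m * z) >]].

Lemma ringA_poly q : ringA (polyK q).
Proof. exact: integral_id. Qed.

Lemma ringA_X m : ringA (polyK 'X ^+ m).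
Proof. by rewrite -rmorphXn; apply: ringA_poly. Qed.

Lemma overlapP z :
  reflect (exists m, ringA (polyK 'X ^+ m * z)) (z \in overlap).
Proof. by rewrite inE; apply: asboolP. Qed.

Lemma overlap_zmod_closed : zmod_closed overlap.
Proof.
split; first by apply/overlapP; exists 0%N; rewrite mulr0; apply: integral0.
move=> a b /overlapP[m Am] /overlapP[l Bl]; apply/overlapP; exists (m + l)%N.
rewrite mulrBr {1}addnC !exprD -!mulrA.
by apply: integral_sub; apply: integral_mul => //; apply: ringA_X.
Qed.

HB.instance Definition _ := GRing.isZmodClosed.Build K overlap
  overlap_zmod_closed.

Lemma overlap_cst c z : z \in overlap -> cstK c * z \in overlap.
Proof.
move=> /overlapP[m Am]; apply/overlapP; exists m.
by rewrite mulrCA; apply: integral_mul => //; apply: ringA_poly.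
Qed.

Lemma overlapX z e : z \in overlap -> z ^+ e \in overlap.
Proof.
move=> /overlapP[m Am]; apply/overlapP; exists (m * e)%N.
rewrite exprM -exprMn; elim: e => [|e IHe]; first exact: integral1.
by rewrite exprS; apply: integral_mul.
Qed.

Record sections := MkSection { section_val : K; _ : section_val \in overlap }.

HB.instance Definition _ := [isSub for section_val].
HB.instance Definition _ := [Choice of sections by <:].
HB.instance Definition _ := [SubChoice_isSubZmodule of sections by <:].

Definition scale_section (c : k) (s : sections) : sections :=
  MkSection (overlap_cst c (valP s)).

Fact scale_sectionA a b s :
  scale_section a (scale_section b s) = scale_section (a * b) s.
Proof. by apply: val_inj; rewrite /= rmorphM mulrA. Qed.
Fact scale_section1 : left_id 1 scale_section.
Proof. by move=> s; apply: val_inj; rewrite /= rmorph1 mul1r. Qed.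
Fact scale_sectionDr : right_distributive scale_section +%R.
Proof. by move=> a s1 s2; apply: val_inj; rewrite /= mulrDr. Qed.
Fact scale_sectionDl s : {morph scale_section^~ s : a b / a + b}.
Proof. by move=> a b; apply: val_inj; rewrite /= rmorphD mulrDl. Qed.

HB.instance Definition _ := GRing.Zmodule_isLmodule.Build k sections
  scale_sectionA scale_section1 scale_sectionDr scale_sectionDl.

(* Image of the Cech map A (+) B -> Gamma(U' /\ V', O_C). *)
Definition cech_image : {pred sections} :=
  [pred s | `[< exists a b, [/\ ringA a, ringB b & section_val s = a - b] >]].

Lemma cech_imageP s :
  reflect (exists a b, [/\ ringA a, ringB b & section_val s = a - b])
          (s \in cech_image).
Proof. by rewrite inE; apply: asboolP. Qed.

Lemma cech_image_zmod_closed : zmod_closed cech_image.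
Proof.
split; first by apply/cech_imageP; exists 0, 0; split;
  [exact: integral0 | exact: integral0 | rewrite subr0].
move=> s1 s2 /cech_imageP[a1 [b1 [A1 B1 e1]]] /cech_imageP[a2 [b2 [A2 B2 e2]]].
apply/cech_imageP; exists (a1 - a2), (b1 - b2).
split; [exact: integral_sub | exact: integral_sub |].
by rewrite -[section_val _]/(val (s1 - s2)) raddfB /= e1 e2 opprD addrACA -opprD.
Qed.

HB.instance Definition _ := GRing.isZmodClosed.Build sections cech_image
  cech_image_zmod_closed.

Lemma cech_image_scale c s : s \in cech_image -> c *: s \in cech_image.
Proof.
move=> /cech_imageP[a [b [Aa Bb e]]]; apply/cech_imageP.
exists (cstK c * a), (cstK c * b); split; last by rewrite /= e mulrBr.
- by apply: integral_mul => //; apply: ringA_poly.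
- apply: integral_mul => //.
  have -> : cstK c = polyVK c%:P by rewrite /polyVK map_polyC hornerC.
  exact: integral_id.
Qed.

(* H^1(C, O_C) = Gamma(U' /\ V', O_C) / (A + B) *)
Definition H1 := Quotient.quot cech_image.
HB.instance Definition _ := GRing.Zmodule.on H1.
HB.instance Definition _ := EqQuotient.on H1.

Definition cech_class (s : sections) : H1 := \pi s.

Lemma cech_class_eq s1 s2 :
  (cech_class s1 == cech_class s2) = (s1 - s2 \in cech_image).
Proof. by rewrite (Quotient.idealrBE cech_image s1 s2). Qed.

Fact cech_class_is_zmod_morphism : zmod_morphism cech_class.
Proof. by move=> s1 s2; rewrite /cech_class piE. Qed.
HB.instance Definition _ := GRing.isZmodMorphism.Build sections H1 cech_class
  cech_class_is_zmod_morphism.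

Definition scale_H1 (c : k) (h : H1) : H1 := cech_class (c *: repr h).

Lemma cech_classZ c s : cech_class (c *: s) = scale_H1 c (cech_class s).
Proof.
apply/eqP; rewrite cech_class_eq -scalerBr; apply: cech_image_scale.
by rewrite -cech_class_eq /cech_class reprK.
Qed.

Lemma H1_ind (P : H1 -> Prop) : (forall s, P (cech_class s)) -> forall h, P h.
Proof. by move=> Ps h; rewrite -[h]reprK; apply: Ps. Qed.

Fact scale_H1A a b h : scale_H1 a (scale_H1 b h) = scale_H1 (a * b) h.
Proof. by elim/H1_ind: h => s; rewrite -!cech_classZ scalerA. Qed.
Fact scale_H11 : left_id 1 scale_H1.
Proof. by elim/H1_ind=> s; rewrite -cech_classZ scale1r. Qed.
Fact scale_H1Dr : right_distributive scale_H1 +%R.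
Proof.
move=> a; elim/H1_ind=> s1; elim/H1_ind=> s2.
by rewrite -!cech_classZ -!raddfD /= -cech_classZ scalerDr.
Qed.
Fact scale_H1Dl h : {morph scale_H1^~ h : a b / a + b}.
Proof.
by elim/H1_ind: h => s a b; rewrite -!cech_classZ -raddfD /= scalerDl.
Qed.

HB.instance Definition _ := GRing.Zmodule_isLmodule.Build k H1
  scale_H1A scale_H11 scale_H1Dr scale_H1Dl.

(* The class in H^1 of z, for z in Gamma(U' /\ V', O_C) (and 0 otherwise). *)
Definition H1_class (z : K) : H1 := cech_class (insubd 0 z).

(* The value is a lift to Gamma(U' /\ V', O_C) raised to the power p and then
   mapped back to H^1; frobenius_class shows it does not depend on the lift. *)
Definition frobenius (p : nat) (h : H1) : H1 :=
  H1_class (section_val (repr h) ^+ p).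

Lemma frobenius_class p z : p \in [pchar k] -> z \in overlap ->
  frobenius p (H1_class z) = H1_class (z ^+ p).
Proof.
move=> kp zO; have Kp : p \in [pchar K] by apply: (rmorph_pchar cstK).
rewrite /frobenius /H1_class; apply/eqP; rewrite cech_class_eq.
set s := repr _; have : s - insubd 0 z \in cech_image.
  by rewrite -cech_class_eq /cech_class reprK.
case/cech_imageP=> a [b [Aa Bb]]; rewrite -[section_val _]/(val (_ - _)) raddfB.
rewrite /= -[section_val (insubd _ _)]/(val _) insubdK // => e.
apply/cech_imageP; exists (a ^+ p), (b ^+ p).
have integralX (R : comNzRingType) (g : {rmorphism R -> K}) w m :
    integralOver g w -> integralOver g (w ^+ m).
  move=> gw; elim: m => [|m IHm]; first exact: integral1.
  by rewrite exprS; apply: integral_mul.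
split; [exact: integralX | exact: integralX |].
rewrite -[section_val _]/(val (_ - _)) raddfB /= !(insubdK 0) ?overlapX //;
  last exact: (valP s).
by rewrite -!(pFrobenius_autE Kp) -!rmorphB /= e.
Qed.

Definition p_semilinear (p : nat) (G : H1 -> H1) : Prop :=
  {morph G : h1 h2 / h1 + h2} /\ forall c h, G (c *: h) = c ^+ p *: G h.

(* k is algebraically closed in K(C).  For K separable over k(x) this says that
   C is geometrically irreducible; it excludes constant field extensions such as
   y^n = u with u in k, which satisfy kummer_cover below. *)
Definition full_constant_field : Prop :=
  forall z : K, algebraicOver cstK z -> exists c, z = cstK c.

(* g = dim_k H^1(C, O_C) *)
Definition is_genus (g : nat) : Prop := inhabited (Vector.axiom g H1).

End CoverOfTheLine.

Section KummerPresentation.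
Variables (k : fieldType) (n : nat) (u : k) (fs : nat -> {poly k}).

Definition kummer_f : {poly k} := u *: \prod_(1 <= j < n) fs j ^+ j.

(* Degree; the polynomials it is applied to are nonzero. *)
Definition pdeg (q : {poly k}) : nat := (size q).-1.

Definition kummer_m (i : nat) : int :=
  Num.ceil ((i * pdeg kummer_f)%:R / n%:R : rat)
  - (\sum_(1 <= j < n) pdeg (fs j) * (j * i %/ n))%N%:Z.

Variables (K : fieldExtType {fraction {poly k}}) (y : K).

(* K = k(x)(y) is a cyclic extension of degree n of k(x); the f_j with
   1 <= j < n are the values fs j, and the other values of fs are not used. *)
Record kummer_cover : Prop := {
  kummer_char : n%:R != 0 :> k;
  kummer_roots_of_unity : exists z : k, n.-primitive_root z;
  kummer_unit : u != 0;
  kummer_separable : forall j, (1 <= j < n)%N -> separable_poly (fs j);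
  kummer_coprime : forall i j,
    (1 <= i < n)%N -> (1 <= j < n)%N -> i != j -> coprimep (fs i) (fs j);
  kummer_irreducible :
    irreducible_poly ('X^n - (kummer_f%:F)%:P : {poly {fraction {poly k}}});
  kummer_equation : y ^+ n = polyK K kummer_f;
  kummer_generator : <<1; y>>%VS = fullv
}.

Definition kummer_elt (i t : nat) : K :=
  y ^+ i / \prod_(1 <= j < n) polyK K (fs j) ^+ (j * i %/ n)
    / polyK K 'X ^+ t.

Definition kummer_class (i t : nat) : H1 K := H1_class (kummer_elt i t).

(* Coefficient of x^e for an integer e, which is 0 if e < 0. *)
Definition coefz (q : {poly k}) (e : int) : k :=
  if e is Posz d then q`_d else 0.

(* Since kummer_m is nonnegative (kummer_m_ge0), the bound `|kummer_m i| on the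
   exponents of 1/x is kummer_m i itself.  A prefactor as below is an element of
   k(x), with possibly negative exponents of the f_j; that it is a polynomial q
   is part of the assertion. *)
Definition frobenius_formula (p : nat) (G : H1 K -> H1 K) : Prop :=
  forall i, (1 <= i < n)%N ->
  let r := (p * i %% n)%N in
  exists2 q : {poly k},
    q%:F = kummer_f%:F ^+ (p * i %/ n) /
      \prod_(1 <= j < n)
        (fs j)%:F ^ ((p * (j * i %/ n))%N%:Z - (j * r %/ n)%N%:Z) &
    forall t, (1 <= t < `|kummer_m i|)%N ->
      G (kummer_class i t) =
        \sum_(1 <= w < `|kummer_m r|%N)
          coefz q ((p * t)%N%:Z - w%:Z) *: kummer_class r w.

Lemma kummer_n_gt0 : kummer_cover -> (0 < n)%N.
Proof. by move=> hC; case: n (kummer_char hC) => //; rewrite eqxx. Qed.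

Lemma pdeg_kummer_f :
  kummer_cover -> pdeg kummer_f = (\sum_(1 <= j < n) j * pdeg (fs j))%N.
Proof.
move=> hC; rewrite /pdeg size_scale ?(kummer_unit hC) // !big_nat.
suff [-> _]: (size (\prod_(1 <= j < n | (1 <= j < n)%N) fs j ^+ j)).-1 =
    (\sum_(1 <= j < n | (1 <= j < n)%N) j * (size (fs j)).-1)%N /\
    \prod_(1 <= j < n | (1 <= j < n)%N) fs j ^+ j != 0 by [].
elim/big_rec2: _ => [|j d q]; first by rewrite size_poly1 oner_neq0.
move=> /(kummer_separable hC)/separable_poly_neq0 fj0 [<- q0].
rewrite mulf_neq0 ?expf_neq0 // size_mul ?expf_neq0 //; split=> //.
have e0 : fs j ^+ j != 0 by rewrite expf_neq0.
rewrite mulnC -size_exp.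
by rewrite {1}(polySpred e0) {1}(polySpred q0) addnS.
Qed.

Lemma kummer_m_ge0 i : kummer_cover -> 0 <= kummer_m i.
Proof.
move=> hC; have n0 := kummer_n_gt0 hC.
rewrite subr_ge0 -(ler_int rat); apply: le_trans (ceil_ge _).
rewrite pdeg_kummer_f // ler_pdivlMr ?ltr0n // -natrM ler_nat.
rewrite big_distrl big_distrr; apply: leq_sum => j _ /=.
rewrite -mulnA (_ : i * (j * _) = pdeg (fs j) * (j * i))%N.
  by rewrite leq_mul // leq_trunc_div.
by rewrite mulnCA mulnA [RHS]mulnC.
Qed.

Lemma kummer_elt_overlap i t : kummer_cover -> kummer_elt i t \in overlap (K := K).
Proof.
move=> hC; have n0 := kummer_n_gt0 hC.
apply/overlapP; exists t.
rewrite mulrC divfK ?expf_neq0 ?polyKX_neq0 //.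
set z := _ / _; suff [q zE] : exists q, z ^+ n = polyK K q.
  exists ('X^n - q%:P); first exact: monicXnsubC.
  by rewrite rmorphB /= map_polyXn map_polyC rootE !hornerE zE subrr.
exists (u ^+ i *: \prod_(1 <= j < n) fs j ^+ (j * i - j * i %/ n * n)).
rewrite expr_div_n exprAC (kummer_equation hC) -prodrXl -rmorphXn /=.
apply: (canLR (mulfK _)).
  rewrite big_nat prodf_seq_neq0; apply/allP => j _; apply/implyP.
  move=> /(kummer_separable hC)/separable_poly_neq0 fj0.
  by rewrite !expf_neq0 // polyK_eq0.
rewrite /kummer_f exprZn -prodrXl -!mul_polyC !rmorphM.
rewrite -[RHS]mulrA; congr (_ * _); rewrite !rmorph_prod -big_split /=; apply: eq_bigr => j _ /=.
by rewrite -!rmorphXn -!exprM -rmorphM -exprD subnK // leq_trunc_div.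
Qed.

End KummerPresentation.

(* Main.v *)
Require Import Defs.
From mathcomp Require Import all_boot all_order all_algebra all_field.
From mathcomp Require Import boolp.

Set Implicit Arguments.
Unset Strict Implicit.
Unset Printing Implicit Defensive.

Import GRing.Theory Num.Theory Order.TTheory.
Local Open Scope ring_scope.

(** Write D_i for the product of the f_j^(floor(ji/n)), g_i = y^i / D_i and
    G_i = u^i times the product of the f_j^(ji mod n), so that g_i^n = G_i; the
    g_i with 0 <= i < n form a basis of K over k(x).  Since f has degree the sum
    of the j deg f_j, the integer m_i is the rounded up quotient of deg G_i by n.

    The integral closures are A = sum of g_i k[x] and
    B = sum of g_i x^(-m_i) k[1/x].  Indeed the Galois group consists of the
    maps y |-> zeta y for zeta an n-th root of unity in k; averaging over it
    (kummer_projection), if the sum of the g_i h_i is integral then so is each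
    g_i h_i, hence so is its n-th power G_i h_i^n, which lies in k(x).  As k[x]
    and k[1/x] are integrally closed (integral_fraction), G_i h_i^n lies in k[x]
    or k[1/x].  In both cases the denominator of h_i involves x at most: G_i has
    no factor of multiplicity n, so it cannot absorb the n-th power of a
    denominator (power_fraction).  At infinity the condition is
    n deg h_i + deg G_i <= 0, that is deg h_i <= - m_i.

    Therefore H^1 is the sum over i of
    g_i k[x, 1/x] / (g_i k[x] + g_i x^(-m_i) k[1/x]): a monomial g_i x^(-w) has
    nonzero class only for 1 <= w < m_i, and these classes are independent.
    In closed form (H1_class_laurent), the class of g_i q(x) / x^M is the sum
    of the coefficients of x^(M - w) in q times the classes of g_i x^(-w).  The
    basis follows, and so does the Frobenius formula, because
    (g_i x^(-t))^p = g_r q x^(-pt), where r = pi mod n and q is a polynomial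
    (kummer_elt_frobenius).

    The genus is thus the sum of the max(m_i - 1, 0).  If m_i = 0 with i > 0,
    then G_i is constant and g_i is algebraic over k but not in k; so under the
    hypothesis on constants all m_i are positive.  For the upper bound,
    deg G_i + deg G_(n-i) is n times a sum of some of the deg f_j, which gives
    m_i + m_(n-i) <= 1 + sum of the deg f_j <= 1 + deg f. *)

(** * Fractions of polynomials *)

(** With g = gcd(d, s) and s = t g, separability makes g and t coprime; cancelling
    g^n in g^(n+1) | t^n g^n leaves g | t^n, so that g = 1.  Then d is prime to
    s, while a power of d divides a power of s. *)
Lemma separable_dvd_exp (k : fieldType) (s d : {poly k}) n :
  separable_poly s -> d ^+ n.+1 %| s ^+ n -> d %= 1.
Proof.
move=> sep_s dvd_ds.
suff cop_ds : coprimep d s.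
  have cop : coprimep (d ^+ n.+1) (s ^+ n) by rewrite coprimep_expl ?coprimep_expr.
  have {cop} := coprimepP _ _ cop _ (dvdpp _) dvd_ds.
  rewrite -!size_poly_eq1 => /eqP sz_dn.
  have d0 : d != 0.
    by apply/eqP=> d0; move: sz_dn; rewrite d0 expr0n size_poly0.
  have /eqP := size_exp d n.+1; rewrite sz_dn eq_sym muln_eq0 orbF.
  by rewrite [size d]polySpred.
set g := gcdp d s; have /dvdpP[t s_gt] : g %| s by apply: dvdp_gcdr.
have cop_gt : coprimep g t.
  by move: sep_s; rewrite s_gt separable_mul coprimep_sym => /and3P[].
have g0 : g != 0.
  by apply: dvdpN0 (dvdp_gcdr d s) (separable_poly_neq0 sep_s).
have dvd_gs : g ^+ n.+1 %| s ^+ n.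
  by apply: dvdp_trans dvd_ds; rewrite dvdp_exp2r // dvdp_gcdl.
have dvd_gt : g %| t ^+ n.
  by move: dvd_gs; rewrite [in s ^+ n]s_gt exprMn exprS dvdp_mul2r ?expf_neq0.
rewrite /coprimep size_poly_eq1.
exact: (coprimepP _ _ (coprimep_expr n cop_gt) _ (dvdpp g) dvd_gt).
Qed.

Lemma coprimep_prodr (k : fieldType) (I : eqType) (r : seq I)
    (F : I -> {poly k}) p :
  {in r, forall i, coprimep p (F i)} -> coprimep p (\prod_(i <- r) F i).
Proof.
move=> copF; rewrite big_seq.
by elim/big_ind: _ => [|a b copa copb|//]; rewrite ?coprimep1 // coprimepMr copa.
Qed.

Lemma separable_prod (k : fieldType) (I : eqType) (r : seq I) (F : I -> {poly k}) :
    uniq r -> {in r, forall i, separable_poly (F i)} ->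
    {in r &, forall i j, i != j -> coprimep (F i) (F j)} ->
  separable_poly (\prod_(i <- r) F i).
Proof.
elim: r => [|i r IHr] /=.
  by rewrite big_nil unlock derivC coprime1p.
case/andP=> r'i Ur sepF copF; rewrite big_cons separable_mul.
rewrite sepF ?mem_head // IHr //=.
- apply: coprimep_prodr => j rj; apply: copF; rewrite ?mem_head ?inE ?rj ?orbT //.
  by apply: contraNneq r'i => ->.
- by move=> j rj; apply: sepF; rewrite inE rj orbT.
- by move=> j l rj rl; apply: copF; rewrite inE ?rj ?rl orbT.
Qed.

Section FractionsOfPolynomials.

Variables (k : fieldType) (L : fieldType) (phi : {rmorphism {poly k} -> L}).
Hypothesis phi_inj : injective phi.

Let phi_eq0 q : (phi q == 0) = (q == 0).
Proof. by rewrite raddf_eq0. Qed.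

Lemma coprime_fraction a b : b != 0 ->
  exists a' b', [/\ coprimep a' b', b' != 0 & phi a / phi b = phi a' / phi b'].
Proof.
move=> b0; set g := gcdp a b.
have g0 : g != 0 by rewrite gcdp_eq0 negb_and b0 orbT.
have ag : g %| a by apply: dvdp_gcdl.
have bg : g %| b by apply: dvdp_gcdr.
exists (a %/ g), (b %/ g); split; first by rewrite coprimep_div_gcd // b0 orbT.
  by rewrite dvdp_div_eq0.
rewrite -{1}(divpK ag) -{1}(divpK bg) !rmorphM /= -mulf_div divff ?mulr1 //.
by rewrite phi_eq0.
Qed.

Lemma fraction_unit_denom a b : b %= 1 -> exists q, phi a / phi b = phi q.
Proof.
move=> b1; have b0 : b != 0.
  by apply: contraTneq b1 => ->; rewrite -size_poly_eq1 size_poly0.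
have /dvdpP[q aE] : b %| a by rewrite (eqp_dvdl _ b1) dvd1p.
by exists q; rewrite aE rmorphM mulfK ?phi_eq0.
Qed.

(** Clearing denominators in a monic equation for a / b in lowest terms shows
    that b divides a power of a.  The embedding phi is arbitrary because the
    result is needed both for q |-> q(x) and for q |-> q(1/x). *)
Lemma integral_fraction a b : b != 0 -> integralOver phi (phi a / phi b) ->
  exists q, phi a / phi b = phi q.
Proof.
move=> /(coprime_fraction a)[a' [b' [cop b0 ->]]] [p mon_p p_root].
apply: fraction_unit_denom.
have pb0 : phi b' != 0 by rewrite phi_eq0.
have [d szp] : exists d, size p = d.+1.
  by exists (size p).-1; rewrite -polySpred ?monic_neq0.
have : a' ^+ d + b' * \sum_(i < d) p`_i * a' ^+ i * b' ^+ (d - i.+1) = 0.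
  apply/eqP; rewrite -phi_eq0; apply/eqP.
  transitivity ((map_poly phi p).[phi a' / phi b'] * phi b' ^+ d); last first.
    by rewrite (rootP p_root) mul0r.
  rewrite (@horner_coef_wide _ d.+1) ?size_map_poly_id0 ?szp //; last first.
    by rewrite (monicP mon_p) rmorph1 oner_eq0.
  rewrite big_ord_recr /= rmorphD addrC mulrDl; congr (_ + _); last first.
    rewrite rmorphM rmorph_sum /= mulr_sumr mulr_suml; apply: eq_bigr => i _.
    rewrite coef_map !rmorphM !rmorphXn /= expr_div_n.
    have -> : phi b' ^+ d = phi b' * phi b' ^+ (d - i.+1) * phi b' ^+ i.
      by rewrite -exprS -exprD -subSn // subSS subnK // ltnW.
    rewrite [RHS]mulrACA divfK ?expf_neq0 // [X in _ = X * _]mulrCA.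
    by rewrite -[RHS]mulrA; congr (_ * _); rewrite mulrAC.
  have -> : (map_poly phi p)`_d = 1.
    rewrite coef_map -[d]/(d.+1.-1) -szp -lead_coefE (monicP mon_p).
    exact: rmorph1.
  by rewrite mul1r expr_div_n divfK ?expf_neq0 // rmorphXn.
move/eqP; rewrite addr_eq0 -mulrN => /eqP a'd.
have : b' %| a' ^+ d by rewrite a'd dvdp_mulr.
have := coprimepP _ _ (coprimep_expl d cop) b'.
by move=> H /H; apply; rewrite dvdpp.
Qed.

(** If b is the denominator in lowest terms, b^n divides G, hence s^(n-1), whose
    factors have multiplicity less than n. *)
Lemma power_fraction (s G Q : {poly k}) n a b :
    (0 < n)%N -> b != 0 -> separable_poly s -> G %| s ^+ n.-1 ->
    (phi a / phi b) ^+ n * phi G = phi Q ->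
  exists q, phi a / phi b = phi q.
Proof.
case: n => // n _ /(coprime_fraction a)[a' [b' [cop b0 ->]]] sep_s Gs eqQ.
apply: fraction_unit_denom; apply: (separable_dvd_exp (n := n) sep_s).
apply: dvdp_trans Gs.
have pb0 : phi b' != 0 by rewrite phi_eq0.
have e : a' ^+ n.+1 * G = Q * b' ^+ n.+1.
  apply: phi_inj; rewrite !rmorphM !rmorphXn /= -eqQ expr_div_n.
  by rewrite mulrAC divfK ?expf_neq0.
rewrite -(@Gauss_dvdpr _ _ (a' ^+ n.+1)) ?e ?dvdp_mull //.
by rewrite coprimep_expl // coprimep_expr // coprimep_sym.
Qed.

End FractionsOfPolynomials.

Lemma fractionP (R : idomainType) (h : {fraction R}) :
  exists a b, b != 0 /\ h = tofrac a / tofrac b.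
Proof.
elim/quotW: h => r; exists (frac r).1, (frac r).2.
have d0 := denom_ratioP r; split=> //.
rewrite -[LHS](mulfK (_ : tofrac (frac r).2 != 0)) ?tofrac_eq0 //; congr (_ / _).
rewrite /tofrac; unlock; rewrite -[LHS]FracField.pi_mul.
apply/eqmodP; rewrite /= FracField.equivfE /FracField.mulf.
by rewrite !numden_Ratio ?mulf_neq0 ?oner_neq0 // !mulr1 mulrC.
Qed.

(** * The two charts of the projective line *)

Section FunctionsOnTheLine.

Variables (k : fieldType) (K : fieldExtType {fraction {poly k}}).
Implicit Types (q : {poly k}) (h : {fraction {poly k}}).

Local Notation x := (polyK K 'X).

Lemma polyK_inj : injective (polyK K).
Proof.
by move=> q1 q2 /eqP; rewrite -subr_eq0 -rmorphB polyK_eq0 subr_eq0 => /eqP.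
Qed.

Lemma algfM (h1 h2 : {fraction {poly k}}) : (h1 * h2)%:A = h1%:A * h2%:A :> K.
Proof. exact: (rmorphM (in_alg K)). Qed.

Lemma algfX h e : (h ^+ e)%:A = h%:A ^+ e :> K.
Proof. exact: (rmorphXn (in_alg K)). Qed.

Lemma algfV h : (h^-1)%:A = h%:A^-1 :> K.
Proof. exact: (fmorphV (in_alg K)). Qed.

Lemma algf_poly q : (q%:F)%:A = polyK K q. Proof. by []. Qed.

Lemma algf_fraction a b : (a%:F / b%:F)%:A = polyK K a / polyK K b.
Proof. by rewrite algfM algfV. Qed.

(** The polynomial x^N q(1/x), for deg q <= N: an element of k[1/x] is thereby
    handled as a polynomial in x divided by a power of x, with a bound on its
    degree. *)
Definition revp N q : {poly k} := \poly_(i < N.+1) q`_(N - i).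

Lemma size_revp N q : (size (revp N q) <= N.+1)%N.
Proof. exact: size_poly. Qed.

Lemma revpK N q : (size q <= N.+1)%N -> revp N (revp N q) = q.
Proof.
move=> szq; apply/polyP => i; rewrite coef_poly.
case: ltnP => [|/(leq_trans szq)/leq_sizeP->//].
by rewrite ltnS => iN; rewrite coef_poly ltnS leq_subr subKn.
Qed.

Lemma revp_eq0 N q : (size q <= N.+1)%N -> revp N q = 0 -> q = 0.
Proof.
move=> /revpK qE q0; rewrite -qE q0; apply/polyP => i.
by rewrite coef_poly !coef0 if_same.
Qed.

Lemma polyK_sum N (E : nat -> k) :
  polyK K (\poly_(i < N) E i) = \sum_(i < N) cstK K (E i) * x ^+ i.
Proof.
rewrite poly_def rmorph_sum; apply: eq_bigr => i _ /=.
by rewrite -mul_polyC rmorphM rmorphXn.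
Qed.

Lemma polyVK_revp N q : (size q <= N.+1)%N ->
  polyVK K q = polyK K (revp N q) / x ^+ N.
Proof.
move=> szq; rewrite polyK_sum mulr_suml /polyVK.
rewrite (@horner_coef_wide _ N.+1); last by rewrite (leq_trans (size_poly _ _)).
rewrite (reindex_inj rev_ord_inj); apply: eq_bigr => i _ /=.
have iN : (i <= N)%N by rewrite -ltnS.
rewrite coef_map subSS -mulrA; congr (_ * _).
have -> : x ^+ N = x ^+ (N - i) * x ^+ i by rewrite -exprD subnK.
by rewrite exprVn invfM mulrCA divff ?mulr1 // expf_neq0 ?polyKX_neq0.
Qed.

Lemma polyVK_inj : injective (polyVK K).
Proof.
apply: raddf_inj => q; rewrite -[LHS]/(polyVK K q).
rewrite (polyVK_revp (leqnSn (size q))) => /eqP.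
rewrite mulf_eq0 invr_eq0 expf_eq0 (negPf (polyKX_neq0 K)) andbF orbF.
by rewrite polyK_eq0 => /eqP/revp_eq0->.
Qed.

Lemma ringA_base h : ringA (h%:A : K) -> exists q, h%:A = polyK K q.
Proof.
have [a [b [b0 ->]]] := fractionP h.
by rewrite algf_fraction => /integral_fraction; apply => //; apply: polyK_inj.
Qed.

Lemma ringB_base h : ringB (h%:A : K) ->
  exists N q, (size q <= N.+1)%N /\ h%:A = polyK K q / x ^+ N.
Proof.
have [a [b [b0 ->]]] := fractionP h.
set N := maxn (size a) (size b).
have szb : (size b <= N.+1)%N by rewrite leqW ?leq_maxr.
have -> : (a%:F / b%:F)%:A = polyVK K (revp N a) / polyVK K (revp N b).
  rewrite algf_fraction !(@polyVK_revp N) ?size_revp //.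
  rewrite !revpK ?leqW ?leq_maxl ?leq_maxr //.
  rewrite -mulf_div divff ?mulr1 // invr_eq0 expf_neq0 ?polyKX_neq0 //.
move/integral_fraction => [||q ->]; first exact: polyVK_inj.
  by apply: contra_neq b0 => /revp_eq0->.
by exists (size q), (revp (size q) q); rewrite size_revp -polyVK_revp.
Qed.

End FunctionsOnTheLine.

(** * Classes in the first cohomology group *)

Section CechClasses.

Variables (k : fieldType) (K : fieldExtType {fraction {poly k}}).
Implicit Types (z : K) (c : k).

Lemma H1_class_sum (I : Type) (r : seq I) (P : pred I) (E : I -> K) :
    (forall i, P i -> E i \in overlap (K := K)) ->
  H1_class (\sum_(i <- r | P i) E i) = \sum_(i <- r | P i) H1_class (E i).
Proof.
move=> EO.
have val0 z : z \in overlap (K := K) -> val (insubd (0 : sections K) z) = z.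
  by move=> zO; rewrite insubdK.
suff [] : H1_class (\sum_(i <- r | P i) E i) = \sum_(i <- r | P i) H1_class (E i)
          /\ \sum_(i <- r | P i) E i \in overlap (K := K) by [].
elim/big_rec2: _ => [|i h z Pi [zE zO]].
  split; last exact: rpred0.
  transitivity (cech_class (0 : sections K)); last exact: raddf0.
  by congr cech_class; apply: val_inj; rewrite val0 ?rpred0.
split; last by rewrite rpredD ?EO.
rewrite -zE /H1_class -raddfD; congr cech_class; apply: val_inj.
by rewrite raddfD /= -!/(val _) !val0 ?rpredD ?EO.
Qed.

Lemma H1_class_scale c z : z \in overlap (K := K) ->
  H1_class (cstK K c * z) = c *: H1_class z.
Proof.
move=> zO; rewrite /H1_class -[RHS]/(scale_H1 _ _) -cech_classZ; congr cech_class.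
apply: val_inj; rewrite insubdK ?overlap_cst //=.
by rewrite -[section_val _]/(val _) insubdK.
Qed.

Lemma H1_class_eq0 z : z \in overlap (K := K) ->
  H1_class z = 0 <-> exists a b, [/\ ringA a, ringB b & z = a - b].
Proof.
move=> zO; rewrite /H1_class.
have <- : cech_class (0 : sections K) = 0 by apply: raddf0.
split=> [/eqP | [a [b [Aa Bb zE]]]].
  rewrite cech_class_eq subr0 => /cech_imageP[a [b [Aa Bb]]].
  by rewrite -[section_val _]/(val _) insubdK // => zE; exists a, b.
apply/eqP; rewrite cech_class_eq subr0; apply/cech_imageP; exists a, b.
by split=> //; rewrite -[section_val _]/(val _) insubdK.
Qed.

Lemma H1_class_A z : ringA z -> H1_class z = 0.
Proof.
move=> Az; apply/H1_class_eq0; first by apply/overlapP; exists 0%N; rewrite mul1r.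
by exists z, 0; rewrite subr0; split=> //; apply: integral0.
Qed.

Lemma H1_class_B z : z \in overlap (K := K) -> ringB z -> H1_class z = 0.
Proof.
move=> zO Bz; apply/H1_class_eq0 => //.
by exists 0, (- z); rewrite opprK add0r; split=> //;
  [apply: integral0 | apply: integral_opp].
Qed.

Lemma H1_classP (h : H1 K) : exists2 z, z \in overlap (K := K) & h = H1_class z.
Proof.
elim/H1_ind: h => s; exists (val s); first exact: valP.
by rewrite /H1_class valKd.
Qed.

Lemma frobenius_semilinear p : p \in [pchar k] ->
  p_semilinear p (frobenius (K := K) p).
Proof.
move=> kp; have Kp : p \in [pchar K] by apply: (rmorph_pchar (cstK K)).
have add (h1 h2 : H1 K) : frobenius p (h1 + h2) = frobenius p h1 + frobenius p h2.
  have [z1 O1 ->] := H1_classP h1; have [z2 O2 ->] := H1_classP h2.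
  have addE (w1 w2 : K) : w1 \in overlap (K := K) -> w2 \in overlap (K := K) ->
      H1_class w1 + H1_class w2 = H1_class (w1 + w2).
    move=> W1 W2; have := @H1_class_sum bool [:: true; false] xpredT
      (fun b => if b then w1 else w2).
    by rewrite !big_cons !big_nil !addr0 => -> // -[].
  rewrite addE // !frobenius_class ?rpredD // addE ?overlapX //.
  by rewrite -!(pFrobenius_autE Kp) rmorphD.
split=> // c h; have [z zO ->] := H1_classP h.
rewrite -H1_class_scale // !frobenius_class ?overlap_cst //.
by rewrite exprMn -rmorphXn H1_class_scale ?overlapX.
Qed.

End CechClasses.

(** * Coordinates in a basis *)

(** Coordinates of all vectors are picked by choice; independence makes them
    unique, hence linear in the vector. *)
Lemma vector_axiom_basis (R : fieldType) (V : lmodType R) (I : eqType) (s : seq I)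
    (e : I -> V) :
    uniq s ->
    (forall v, exists c : I -> R, v = \sum_(i <- s) c i *: e i) ->
    (forall c : I -> R, \sum_(i <- s) c i *: e i = 0 ->
      {in s, forall i, c i = 0}) ->
  inhabited (Vector.axiom (size s) V).
Proof.
move=> Us /choice[c cE] free_e.
have cP v (d : I -> R) : v = \sum_(i <- s) d i *: e i -> {in s, c v =1 d}.
  rewrite [LHS]cE => /eqP; rewrite -subr_eq0 -sumrB => /eqP cd0 i si.
  apply/eqP; rewrite -subr_eq0; apply/eqP.
  apply: (free_e (fun i => c v i - d i)) si; rewrite -[RHS]cd0.
  by apply: eq_bigr => j _; rewrite scalerBl.
pose s_ (l : 'I_(size s)) := tnth (in_tuple s) l.
have s_in l : s_ l \in s by apply: mem_tnth.
split; exists (fun v => \row_l c v (s_ l)).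
  move=> a v w; apply/rowP => l; rewrite !mxE.
  apply: (cP _ (fun i => a * c v i + c w i)) => //.
  rewrite {1}[v]cE {1}[w]cE scaler_sumr -big_split; apply: eq_bigr => i _.
  by rewrite scalerDl scalerA.
exists (fun r : 'rV_(size s) => \sum_l r 0 l *: e (s_ l)) => [v | r].
  by rewrite [RHS]cE [RHS]big_tnth; apply: eq_bigr => l _; rewrite mxE.
pose d i := if insub (index i s) is Some l then r 0 l else 0.
have dE l : d (s_ l) = r 0 l.
  have -> : d (s_ l) = if insub (val l) is Some l' then r 0 l' else 0.
    by rewrite /d /s_ (tnth_nth (s_ l)) index_uniq.
  by rewrite valK.
apply/rowP => l; rewrite mxE -dE; apply: cP (s_in l).
by rewrite [RHS]big_tnth; apply: eq_bigr => j _; rewrite dE.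
Qed.

(** * The basis of the Kummer extension *)

Lemma pdeg_prod_exp (k : fieldType) (r : seq nat) (F : nat -> {poly k})
    (a : nat -> nat) :
  {in r, forall j, F j != 0} ->
  pdeg (\prod_(j <- r) F j ^+ a j) = (\sum_(j <- r) pdeg (F j) * a j)%N
  /\ \prod_(j <- r) F j ^+ a j != 0.
Proof.
move=> F0; rewrite big_seq [in RHS]big_seq /pdeg.
elim/big_rec2: _ => [|j d q rj [<- q0]]; first by rewrite size_poly1 oner_neq0.
have e0 : F j ^+ a j != 0 by rewrite expf_neq0 ?F0.
rewrite mulf_neq0 // size_mul //; split=> //.
by rewrite -size_exp {1}(polySpred e0) {1}(polySpred q0) addnS.
Qed.

Lemma sum_expr_prim_root (L : fieldType) n (z : L) m : n.-primitive_root z ->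
  \sum_(l < n) (z ^+ l) ^+ m = if (n %| m)%N then n%:R else 0.
Proof.
move=> zP; rewrite (prim_order_dvd zP); case: eqP => [zm1 | /eqP zm1].
  rewrite (eq_bigr (fun=> 1)) ?sumr_const ?card_ord // => l _.
  by rewrite exprAC zm1 expr1n.
(* A geometric sum of ratio z^m, a nontrivial n-th root of unity. *)
apply: (mulfI (_ : z ^+ m - 1 != 0)); first by rewrite subr_eq0.
under eq_bigr do rewrite exprAC.
by rewrite -subrX1 exprAC (prim_expr_order zP) expr1n subrr mulr0.
Qed.

Lemma integral_root_exp (R L : comNzRingType) (phi : {rmorphism R -> L}) n z q :
  (0 < n)%N -> z ^+ n = phi q -> integralOver phi z.
Proof.
move=> n0 zE; exists ('X^n - q%:P); first exact: monicXnsubC.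
by rewrite rmorphB /= map_polyXn map_polyC rootE !hornerE zE subrr.
Qed.

Lemma integral_exp (R L : comNzRingType) (phi : {rmorphism R -> L}) z e :
  integralOver phi z -> integralOver phi (z ^+ e).
Proof.
move=> z_int; elim: e => [|e IHe]; first exact: integral1.
by rewrite exprS; apply: integral_mul.
Qed.

Section KummerCover.

Variables (k : fieldType) (n : nat) (u : k) (fs : nat -> {poly k}).
Variables (K : fieldExtType {fraction {poly k}}) (y : K).
Hypothesis hC : kummer_cover n u fs y.

Local Notation f := (kummer_f n u fs).
Local Notation x := (polyK K 'X).
Local Notation m i := `|kummer_m n u fs i|%N.
Local Notation F := {fraction {poly k}}.

Let n_gt0 : (0 < n)%N := kummer_n_gt0 hC.

Lemma kummer_fs_neq0 : {in index_iota 1 n, forall j, fs j != 0}.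
Proof.
move=> j; rewrite mem_index_iota => /(kummer_separable hC).
exact: separable_poly_neq0.
Qed.

Definition kummer_denom i : {poly k} := \prod_(1 <= j < n) fs j ^+ (j * i %/ n).
(** Up to sign, the norm to k(x) of y^i divided by [kummer_denom i]. *)
Definition kummer_norm i : {poly k} :=
  u ^+ i *: \prod_(1 <= j < n) fs j ^+ (j * i %% n).

Local Notation D := kummer_denom.
Local Notation G := kummer_norm.
Local Notation g i := (kummer_elt n fs y i 0).

Lemma kummer_denom_neq0 i : D i != 0.
Proof. by have [] := pdeg_prod_exp (fun j => j * i %/ n)%N kummer_fs_neq0. Qed.

Lemma kummer_norm_neq0 i : G i != 0.
Proof.
have [_ nz] := pdeg_prod_exp (fun j => j * i %% n)%N kummer_fs_neq0.
by rewrite scaler_eq0 negb_or nz expf_neq0 ?(kummer_unit hC).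
Qed.

Lemma kummer_f_norm i : f ^+ i = G i * D i ^+ n.
Proof.
rewrite /kummer_f exprZn -scalerAl -!prodrXl -big_split /=; congr (_ *: _).
by apply: eq_bigr => j _; rewrite -!exprM -exprD addnC -divn_eq.
Qed.

Lemma kummer_elt0E i : g i = y ^+ i / polyK K (D i).
Proof.
by rewrite /kummer_elt expr0 divr1 rmorph_prod; under eq_bigr do rewrite -rmorphXn.
Qed.

Lemma kummer_eltE i t : kummer_elt n fs y i t = g i / x ^+ t.
Proof. by rewrite /kummer_elt expr0 divr1. Qed.

Lemma kummer_yE i : y ^+ i = polyK K (D i) * g i.
Proof. by rewrite kummer_elt0E mulrC divfK ?polyK_eq0 ?kummer_denom_neq0. Qed.

Lemma kummer_elt0_exp i : g i ^+ n = polyK K (G i).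
Proof.
rewrite kummer_elt0E expr_div_n exprAC (kummer_equation hC).
rewrite -!rmorphXn kummer_f_norm rmorphM mulfK //.
by rewrite polyK_eq0 expf_neq0 ?kummer_denom_neq0.
Qed.

Lemma pdeg_kummer_norm i :
  pdeg (G i) = (\sum_(1 <= j < n) pdeg (fs j) * (j * i %% n))%N.
Proof.
rewrite /pdeg size_scale ?expf_neq0 ?(kummer_unit hC) //.
exact: (pdeg_prod_exp _ kummer_fs_neq0).1.
Qed.

(** The integer m_i is deg G_i / n rounded up; rounding up is left adjoint to the
    inclusion of the integers. *)
Lemma kummer_m_le i M : (m i <= M)%N = (pdeg (G i) <= n * M)%N.
Proof.
rewrite -lez_nat gez0_abs ?(kummer_m_ge0 _ hC) // lerBlDr ceil_le_int.
rewrite ler_pdivrMr ?ltr0n // -PoszD pmulrn -natrM ler_nat.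
rewrite (pdeg_kummer_f hC) pdeg_kummer_norm mulnDl [in RHS]mulnC.
rewrite -[RHS](leq_add2r ((\sum_(1 <= j < n) pdeg (fs j) * (j * i %/ n)) * n)).
congr (_ <= _)%N; rewrite big_distrr big_distrl -big_split /=.
apply: eq_bigr => j _.
by rewrite -mulnA -mulnDr addnC -divn_eq mulnA [in RHS]mulnC [(j * i)%N]mulnC.
Qed.

Lemma kummer_norm_dvd i : G i %| (\prod_(1 <= j < n) fs j) ^+ n.-1.
Proof.
rewrite dvdpZl ?expf_neq0 ?(kummer_unit hC) // -prodrXl.
elim/big_rec2: _ => [|j a b _]; first exact: dvd1p.
by apply: dvdp_mul; rewrite dvdp_exp2l // -ltnS prednK // ltn_pmod.
Qed.

Lemma kummer_separable_prod : separable_poly (\prod_(1 <= j < n) fs j).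
Proof.
apply: separable_prod; first exact: iota_uniq.
  by move=> j; rewrite mem_index_iota => /(kummer_separable hC).
by move=> i j; rewrite !mem_index_iota; apply: (kummer_coprime hC).
Qed.

Lemma kummer_minPoly : minPoly 1 y = 'X^n - (polyK K f)%:P.
Proof.
have [q minE] := polyOver1P (minPolyOver 1%AS y).
set P : {poly F} := 'X^n - (f%:F)%:P.
have PE : map_poly (in_alg K) P = 'X^n - (polyK K f)%:P.
  by rewrite rmorphB /= map_polyXn map_polyC.
rewrite -PE; have qP : q %| P.
  rewrite -(dvdp_map (in_alg K)) -minE minPoly_dvdp ?alg_polyOver //.
  by rewrite PE rootE !hornerE (kummer_equation hC) subrr.
have szq : size q != 1.
  by rewrite -(size_map_poly (in_alg K)) -minE size_minPoly.
have := (kummer_irreducible hC).2 q szq qP.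
rewrite minE => qeq; congr (map_poly _ _).
apply/eqP; rewrite -eqp_monic ?monicXnsubC //.
have : minPoly 1 y \is monic by apply: monic_minPoly.
by rewrite minE map_monic.
Qed.

Lemma kummer_degree : adjoin_degree 1 y = n.
Proof.
by apply: succn_inj; rewrite -size_minPoly kummer_minPoly size_XnsubC.
Qed.

Lemma kummer_span z : exists h : nat -> F, z = \sum_(i < n) (h i)%:A * y ^+ i.
Proof.
have [q qE] := polyOver1P (Fadjoin_polyOver 1%AS y z).
exists (fun i => q`_i).
have zy : z \in <<1; y>>%VS by rewrite (kummer_generator hC) memvf.
have szq : (size (Fadjoin_poly 1 y z) <= n)%N.
  by rewrite -kummer_degree size_Fadjoin_poly.
rewrite -{1}(Fadjoin_poly_eq zy) (horner_coef_wide _ szq) qE.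
by apply: eq_bigr => i _; rewrite coef_map.
Qed.

Lemma kummer_free (h : nat -> F) : \sum_(i < n) (h i)%:A * y ^+ i = 0 ->
  forall i, (i < n)%N -> h i = 0.
Proof.
move=> h0 i lt_in; set p := map_poly (in_alg K) (\poly_(j < n) h j).
have /polyP/(_ i) : p = 0.
  apply/eqP; rewrite -(@root_small_adjoin_poly _ _ 1%AS y) ?alg_polyOver //.
    rewrite rootE (@horner_coef_wide _ n) ?size_map_poly ?size_poly //.
    rewrite -[X in _ == X]h0; apply/eqP/eq_bigr => j _.
    by rewrite coef_map coef_poly ltn_ord.
  by rewrite kummer_degree size_map_poly size_poly.
by rewrite coef_map coef_poly lt_in coef0 => /eqP; rewrite fmorph_eq0 => /eqP.
Qed.

(** Both y and eta y are roots of Z^n - f, the minimal polynomial of y. *)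
Lemma kummer_galois (eta : k) : eta ^+ n = 1 ->
  exists2 s : 'End(K), kHom 1 fullv s & s y = cstK K eta * y.
Proof.
move=> eta1; have hom1 : kHom 1 1 (\1%VF : 'End(K)) by apply: kHom1.
have rt : root (map_poly (\1%VF : 'End(K)) (minPoly 1 y)) (cstK K eta * y).
  rewrite lfun1_poly kummer_minPoly rootE !hornerE exprMn (kummer_equation hC).
  by rewrite -rmorphXn /= eta1 rmorph1 mul1r subrr.
exists (kHomExtend 1 \1 y (cstK K eta * y)); last exact: (kHomExtend_val hom1 rt).
by rewrite -(kummer_generator hC); exact: (kHomExtendP (subvv _) hom1 rt).
Qed.

(** The sum over the automorphisms y |-> z^l y of z^(-il) times the conjugate of an
    element is n times its component along y^i, and n is invertible in k. *)
Lemma kummer_projection (phi : {rmorphism {poly k} -> K}) (h : nat -> F) :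
    (forall q, phi q \in 1%VS) -> (forall c, integralOver phi (cstK K c)) ->
    integralOver phi (\sum_(i < n) (h i)%:A * y ^+ i) ->
  forall i, (i < n)%N -> integralOver phi ((h i)%:A * y ^+ i).
Proof.
move=> phi1 phi_cst int_z i lt_in; have [z zP] := kummer_roots_of_unity hC.
have zl_n (l : 'I_n) : (z ^+ l) ^+ n = 1.
  by rewrite exprAC (prim_expr_order zP) expr1n.
have /fin_all_exists2[s s_hom sy] := fun l : 'I_n => kummer_galois (zl_n l).
have s_int (l : 'I_n) w : integralOver phi w -> integralOver phi (s l w).
  case=> p mon_p p_w; exists p => //.
  apply: (kHom_root_id (subvf 1) (s_hom l) _ (memvf w) p_w).
  apply/polyOverP => j. by rewrite coef_map phi1.
have sE (l : 'I_n) : s l (\sum_(j < n) (h j)%:A * y ^+ j) =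
    \sum_(j < n) cstK K ((z ^+ l) ^+ j) * ((h j)%:A * y ^+ j).
  rewrite linear_sum; apply: eq_bigr => j _ /=.
  rewrite !(mulr_algl (h j)) linearZ /= -scalerAr; congr (_ *: _).
  have /kHom_monoid_morphism[s1 sM] := s_hom l.
  have sX e : s l (y ^+ e) = s l y ^+ e.
    by elim: e => [|e IHe]; rewrite ?expr0 ?s1 // !exprS sM IHe.
  by rewrite sX sy exprMn -rmorphXn.
suff -> : (h i)%:A * y ^+ i = cstK K n%:R^-1 *
    \sum_(l < n) cstK K ((z ^+ l) ^+ (n - i)) *
      s l (\sum_(j < n) (h j)%:A * y ^+ j).
  apply: integral_mul => //; elim/big_ind: _ => [|a b|l _].
  - exact: integral0.
  - exact: integral_add.
  - by apply: integral_mul => //; apply: s_int.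
transitivity (cstK K n%:R^-1 * \sum_(l < n) \sum_(j < n)
    cstK K ((z ^+ l) ^+ (n - i)) *
      (cstK K ((z ^+ l) ^+ j) * ((h j)%:A * y ^+ j))); last first.
  by congr (_ * _); apply: eq_bigr => l _; rewrite sE mulr_sumr.
rewrite exchange_big (bigD1 (Ordinal lt_in)) //= [X in _ + X]big1 => [|j ne_ji].
  rewrite addr0; under eq_bigr do rewrite mulrA -rmorphM -exprD subnK 1?ltnW //.
  rewrite -mulr_suml -rmorph_sum (sum_expr_prim_root _ zP) dvdnn mulrA -rmorphM.
  by rewrite mulVf ?(kummer_char hC) // rmorph1 mul1r.
under eq_bigr do rewrite mulrA -rmorphM -exprD.
rewrite -mulr_suml -rmorph_sum (sum_expr_prim_root _ zP).
case: ifP => [/eqP dvd_n | _]; last by rewrite rmorph0 mul0r.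
have : i = j %[mod n].
  have niE : (i + (n - i + j) = n + j)%N by rewrite addnA subnKC // ltnW.
  by rewrite -[RHS]modnDl -niE -modnDmr dvd_n addn0.
rewrite !modn_small // => ij; case/eqP: ne_ji; exact/val_inj.
Qed.

Lemma kummer_elt_decomp z : exists h : nat -> F, z = \sum_(i < n) g i * (h i)%:A.
Proof.
have [h ->] := kummer_span z; exists (fun i => h i * (D i)%:F).
apply: eq_bigr => i _; rewrite kummer_yE algfM algf_poly.
by rewrite mulrA mulrC.
Qed.

Lemma kummer_elt0_alg i (h : F) : g i * h%:A = (h / (D i)%:F)%:A * y ^+ i.
Proof.
by rewrite kummer_elt0E algfM algfV algf_poly mulrC mulrA mulrAC.
Qed.

Lemma kummer_elt_free (h : nat -> F) : \sum_(i < n) g i * (h i)%:A = 0 ->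
  forall i, (i < n)%N -> h i = 0.
Proof.
under eq_bigr do rewrite kummer_elt0_alg.
move=> /(kummer_free (h := fun i => h i / (D i)%:F)) h0 i /h0/eqP.
by rewrite mulf_eq0 invr_eq0 tofrac_eq0 (negPf (kummer_denom_neq0 i)) orbF => /eqP.
Qed.

Lemma kummer_elt_projection (phi : {rmorphism {poly k} -> K}) (h : nat -> F) :
    (forall q, phi q \in 1%VS) -> (forall c, integralOver phi (cstK K c)) ->
    integralOver phi (\sum_(i < n) g i * (h i)%:A) ->
  forall i, (i < n)%N -> integralOver phi (g i * (h i)%:A).
Proof.
move=> phi1 phi_cst int_z i lt_in; rewrite kummer_elt0_alg.
apply: (kummer_projection (h := fun j => h j / (D j)%:F)) => //.
by under eq_bigr do rewrite -kummer_elt0_alg.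
Qed.

(** * The integral closures of both coordinate rings *)

Lemma kummer_norm_integral (phi : {rmorphism {poly k} -> K}) i h :
    integralOver phi (g i * h%:A) ->
  integralOver phi (((G i)%:F * h ^+ n)%:A : K).
Proof.
move=> /(@integral_exp _ _ phi _ n); rewrite exprMn kummer_elt0_exp.
by rewrite algfM algfX.
Qed.

Lemma kummer_norm_fraction i (h : F) Q :
  h%:A ^+ n * polyK K (G i) = polyK K Q -> exists q, h%:A = polyK K q.
Proof.
have [a [b [b0 ->]]] := fractionP h.
rewrite algf_fraction.
apply: power_fraction kummer_separable_prod (kummer_norm_dvd i) => //.
exact: polyK_inj.
Qed.

Lemma ringA_components (h : nat -> F) : ringA (\sum_(i < n) g i * (h i)%:A) ->
  forall i, (i < n)%N -> exists q, (h i)%:A = polyK K q.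
Proof.
move=> Az i lt_in.
have phi1 q : polyK K q \in 1%VS by rewrite rpredZ ?mem1v.
have /kummer_norm_integral/ringA_base[Q QE] :=
  kummer_elt_projection phi1 (fun c => ringA_poly K c%:P) Az lt_in.
apply: (@kummer_norm_fraction i _ Q); rewrite -QE mulrC.
by rewrite algfM algfX.
Qed.

(** The n-th power of g_i h_i is some Q / x^N with deg Q <= N.  Then
    (x^N h_i)^n G_i is a polynomial, so that x^N h_i is a polynomial q, and the
    comparison of degrees gives n deg q + deg G_i <= n N. *)
Lemma ringB_components (h : nat -> F) : ringB (\sum_(i < n) g i * (h i)%:A) ->
  forall i, (i < n)%N -> exists N (q : {poly k}),
    (size q + m i <= N.+1)%N /\ (h i)%:A = polyK K q / x ^+ N.
Proof.
move=> Bz i lt_in.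
have x1 : x \in 1%AS by rewrite rpredZ ?mem1v.
have phi1 q : polyVK K q \in 1%VS.
  apply: (@rpred_horner _ 1%AS); last by rewrite rpredV.
  by apply/polyOverP => j; rewrite coef_map rpredZ ?mem1v.
have cst_int c : integralOver (polyVK K) (cstK K c).
  have -> : cstK K c = polyVK K c%:P by rewrite /polyVK map_polyC hornerC.
  exact: integral_id.
have /kummer_norm_integral/ringB_base[N [Q [szQ QE]]] :=
  kummer_elt_projection phi1 cst_int Bz lt_in.
have xN0 e : x ^+ e != 0 by rewrite expf_neq0 ?polyKX_neq0.
have hQ : (('X^N)%:F * h i)%:A ^+ n * polyK K (G i) =
    polyK K (Q * 'X^(N * n.-1)).
  rewrite algfM algf_poly !rmorphM !rmorphXn /= exprMn -mulrA.
  rewrite [_ * polyK K (G i)]mulrC.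
  have {}QE : polyK K (G i) * (h i)%:A ^+ n = polyK K Q / x ^+ N.
    by rewrite -QE algfM algfX.
  rewrite QE mulrCA -exprM; congr (_ * _); apply: (canLR (mulfK (xN0 N))).
  by rewrite -exprD addnC -mulnS prednK.
have [q qE] := kummer_norm_fraction hQ.
have hE : (h i)%:A = polyK K q / x ^+ N.
  rewrite -qE algfM algf_poly.
  by rewrite rmorphXn mulrC mulKf.
have [q0 | q_neq0] := eqVneq q 0.
  (* The zero component satisfies the degree bound once N is at least m_i - 1. *)
  exists (N + m i)%N, 0; rewrite size_poly0 hE q0 rmorph0 !mul0r; split=> //.
  by rewrite leqW ?leq_addl.
exists N, q; split=> //.
have {}hQ : q ^+ n * G i = Q * 'X^(N * n.-1).
  by apply: (@polyK_inj k K); rewrite -hQ qE rmorphM rmorphXn.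
have := congr1 (fun p : {poly k} => size p) hQ.
have Q0 : Q != 0.
  apply: contra_eq_neq hQ => ->; rewrite mul0r mulf_neq0 ?expf_neq0 //.
  exact: kummer_norm_neq0.
rewrite size_mulXn // size_mul ?expf_neq0 ?kummer_norm_neq0 //.
rewrite [size (q ^+ n)]polySpred ?expf_neq0 // size_exp.
rewrite [size (G i)]polySpred ?kummer_norm_neq0 // -/(pdeg (G i)) addSn addnS /=.
move=> szE.
have le_nN : ((size q).-1 * n + pdeg (G i) <= n * N)%N.
  have nNE : (n * N = N * n.-1 + N)%N by rewrite addnC -mulnS prednK // mulnC.
  by rewrite -ltnS szE nNE -addnS leq_add2l.
have le_qN : ((size q).-1 <= N)%N.
  by rewrite -(leq_pmul2l n_gt0) mulnC (leq_trans _ le_nN) ?leq_addr.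
rewrite (polySpred q_neq0) addSn ltnS -leq_subRL // kummer_m_le mulnBr.
by rewrite leq_subRL ?leq_pmul2l // mulnC.
Qed.

Lemma ringA_kummer_elt i : ringA (g i).
Proof. exact: integral_root_exp (kummer_elt0_exp i). Qed.

Lemma ringB_kummer_elt i t : (m i <= t)%N -> ringB (g i / x ^+ t).
Proof.
rewrite kummer_m_le => le_Gt.
have szG : (size (G i) <= (n * t).+1)%N.
  by rewrite polySpred ?kummer_norm_neq0 ?ltnS.
apply: (@integral_root_exp _ _ (polyVK K) _ _ (revp (n * t) (G i))) n_gt0 _.
rewrite -[RHS]/(polyVK K _) (@polyVK_revp _ _ (n * t)) ?size_revp // revpK //.
by rewrite expr_div_n -exprM kummer_elt0_exp mulnC.
Qed.

Lemma kummer_m0 : m 0 = 0%N.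
Proof.
apply/eqP; rewrite -leqn0 kummer_m_le muln0 /kummer_norm expr0 scale1r.
by rewrite big1 ?/pdeg ?size_poly1 // => j _; rewrite muln0 mod0n.
Qed.

(** * The basis of the first cohomology group *)

Lemma kummer_elt_poly_overlap i q M : g i * polyK K q / x ^+ M \in overlap (K := K).
Proof.
apply/overlapP; exists M; rewrite mulrC divfK ?expf_neq0 ?polyKX_neq0 //.
by apply: integral_mul; [apply: ringA_kummer_elt | apply: ringA_poly].
Qed.

(** Depending on the exponent s - M, the section is in A (if it is nonnegative), in
    B (if it is at most - m_i), or it is a basis element; the condition on w
    leaves one term in the last case and none in the others. *)
Lemma H1_class_monomial i s M :
  H1_class (g i * x ^+ s / x ^+ M) =
    \sum_(1 <= w < m i | (s + w)%N == M) kummer_class n fs y i w.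
Proof.
have x0 := polyKX_neq0 K.
have zO : g i * x ^+ s / x ^+ M \in overlap (K := K).
  by rewrite -rmorphXn kummer_elt_poly_overlap.
have [le_Ms | lt_sM] := leqP M s.
  rewrite big1_seq => [|w /andP[/eqP swM]]; last first.
    rewrite mem_index_iota => /andP[w_gt0 _].
    by move: le_Ms; rewrite -swM -[leqRHS]addn0 leq_add2l leqNgt w_gt0.
  apply: H1_class_A; rewrite -mulrA -expfB_cond ?(negPf x0) // -rmorphXn.
  by apply: integral_mul; [apply: ringA_kummer_elt | apply: ringA_poly].
have -> : g i * x ^+ s / x ^+ M = g i / x ^+ (M - s).
  rewrite -[in LHS](subnK (ltnW lt_sM)) exprD invfM -mulrA; congr (_ * _).
  by rewrite mulrCA divff ?mulr1 ?expf_neq0.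
have sum_cond w : ((s + w)%N == M) = (w == M - s)%N.
  by rewrite -{1}(subnKC (ltnW lt_sM)) eqn_add2l.
under eq_bigl do rewrite sum_cond.
rewrite big_nat_cond.
have [lt_m | le_m] := ltnP (M - s) (m i).
  rewrite -big_nat_cond big_mkcond (bigD1_seq (M - s)%N) ?iota_uniq //=; last first.
    by rewrite mem_index_iota subn_gt0 lt_sM.
  rewrite eqxx big1 ?addr0 => [|w /negPf->//].
  by rewrite /kummer_class (kummer_eltE _ (M - s)).
rewrite big1 => [|w /andP[/andP[_ lt_wm] /eqP wE]]; last first.
  by move: lt_wm; rewrite wE ltnNge le_m.
apply: H1_class_B; last exact: ringB_kummer_elt.
by have := kummer_elt_poly_overlap i 1 (M - s); rewrite rmorph1 mulr1.
Qed.

(** The reduction of a Laurent polynomial modulo A + B; the expansion of an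
    arbitrary class and the matrix of Frobenius are both read off from it. *)
Lemma H1_class_laurent i q M :
  H1_class (g i * polyK K q / x ^+ M) =
    \sum_(1 <= w < m i) coefz q (M%:Z - w%:Z) *: kummer_class n fs y i w.
Proof.
have -> : g i * polyK K q / x ^+ M =
    \sum_(s < size q) cstK K q`_s * (g i * x ^+ s / x ^+ M).
  rewrite -{1}[q]coefK polyK_sum mulr_sumr mulr_suml; apply: eq_bigr => s _.
  by rewrite mulrCA !mulrA.
have sO s : g i * x ^+ s / x ^+ M \in overlap (K := K).
  by rewrite -rmorphXn kummer_elt_poly_overlap.
rewrite H1_class_sum => [|s _]; last by apply: overlap_cst; apply: sO.
under eq_bigr do
  rewrite (H1_class_scale _ (sO _)) H1_class_monomial scaler_sumr big_mkcond.
rewrite exchange_big; apply: eq_bigr => w _.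
have [le_wM | lt_Mw] := leqP w M; last first.
  have -> : coefz q (M%:Z - w%:Z) = 0.
    by rewrite -opprB subzn ?(ltnW lt_Mw) // -(prednK (_ : 0 < w - M)%N) ?subn_gt0.
  rewrite scale0r big1 // => s _; case: eqP => // swM.
  by move: lt_Mw; rewrite -swM ltnNge leq_addl.
rewrite subzn //=.
have sE (s : nat) : ((s + w)%N == M) = (s == M - w)%N.
  by rewrite -{1}(subnK le_wM) eqn_add2r.
under eq_bigr do rewrite sE.
rewrite -big_mkcond.
have [lt_q | le_q] := ltnP (M - w) (size q).
  by rewrite (big_pred1 (Ordinal lt_q)).
rewrite nth_default // scale0r big1 // => s /eqP sMw.
by have := ltn_ord s; rewrite sMw ltnNge le_q.
Qed.

Lemma kummer_class_span (h : H1 K) : exists c : nat -> nat -> k,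
  h = \sum_(1 <= i < n) \sum_(1 <= t < m i) c i t *: kummer_class n fs y i t.
Proof.
have [z zO ->] := H1_classP h; have /overlapP[M Az] := zO.
have [c xzE] := kummer_elt_decomp (x ^+ M * z).
have [q qE] : exists q : nat -> {poly k}, forall i, (i < n)%N ->
    (c i)%:A = polyK K (q i).
  suff /fin_all_exists[q qE] : forall i : 'I_n, exists q, (c i)%:A = polyK K q.
    exists (fun i => oapp q 0 (insub i)) => i lt_in.
    by rewrite insubT; apply: (qE (Ordinal lt_in)).
  by move=> i; apply: ringA_components (ltn_ord i); rewrite -xzE.
exists (fun i t => coefz (q i) (M%:Z - t%:Z)).
have -> : z = \sum_(i < n) g i * polyK K (q i) / x ^+ M.
  rewrite -mulr_suml; apply: (canRL (mulfK _)).
    by rewrite expf_neq0 ?polyKX_neq0.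
  by rewrite mulrC xzE; apply: eq_bigr => i _; rewrite qE.
rewrite H1_class_sum => [|i _]; last exact: kummer_elt_poly_overlap.
under eq_bigr do rewrite H1_class_laurent.
rewrite -(big_mkord xpredT (fun i => \sum_(1 <= t < m i)
  coefz (q i) (M%:Z - t%:Z) *: kummer_class n fs y i t)).
(* The summand for i = 0 is empty, because m_0 = 0. *)
by rewrite big_ltn // [X in X + _]big_geq ?kummer_m0 // add0r.
Qed.

(** A relation equates, along each g_i, the principal part of the sum of the
    c_it x^(-t) with q - r / x^N, where q and r / x^N come from A and B.
    After multiplication by x^N the coefficient of x^(N-t) on the right is 0, by
    t >= 1 for q x^N and by deg r <= N - m_i < N - t for r. *)
Lemma kummer_class_free (c : nat -> nat -> k) :
    \sum_(1 <= i < n) \sum_(1 <= t < m i) c i t *: kummer_class n fs y i t = 0 ->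
  forall i t, (1 <= i < n)%N -> (1 <= t < m i)%N -> c i t = 0.
Proof.
move=> c0.
have x0 e : x ^+ e != 0 by rewrite expf_neq0 ?polyKX_neq0.
pose E i t := cstK K (c i t) * kummer_elt n fs y i t.
have EO i t : E i t \in overlap (K := K).
  by apply: overlap_cst; apply: kummer_elt_overlap hC.
have EsumO i : \sum_(1 <= t < m i) E i t \in overlap (K := K) by rewrite rpred_sum.
have /H1_class_eq0[|a [b [Aa Bb zE]]] :
    H1_class (\sum_(1 <= i < n) \sum_(1 <= t < m i) E i t) = 0.
  rewrite -[RHS]c0 H1_class_sum => [|i _]; last exact: EsumO.
  apply: eq_bigr => i _; rewrite H1_class_sum => [|t _]; last exact: EO.
  by apply: eq_bigr => t _; rewrite H1_class_scale //; apply: kummer_elt_overlap hC.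
- by apply: rpred_sum => i _; apply: EsumO.
have [ha aE] := kummer_elt_decomp a; have [hb bE] := kummer_elt_decomp b.
(* The coordinates of the relation along the g_i. *)
pose hE i : F := \sum_(1 <= t < m i) ((c i t)%:P)%:F / 'X%:F ^+ t.
have hEE i : (hE i)%:A = \sum_(1 <= t < m i) cstK K (c i t) / x ^+ t.
  rewrite -[_%:A]/(in_alg K _) rmorph_sum; apply: eq_bigr => t _ /=.
  by rewrite algfM algfV algfX.
have h0 : \sum_(i < n) g i * (hE i - ha i + hb i)%:A = 0.
  transitivity (\sum_(1 <= i < n) \sum_(1 <= t < m i) E i t - a + b); last first.
    by rewrite zE addrAC subrK subrr.
  have -> : \sum_(1 <= i < n) \sum_(1 <= t < m i) E i t =
      \sum_(i < n) g i * (hE i)%:A.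
    rewrite -(big_mkord xpredT (fun i => g i * (hE i)%:A)) big_ltn //.
    rewrite hEE [X in _ * X + _]big_geq ?kummer_m0 // mulr0 add0r.
    apply: eq_bigr => i _; rewrite hEE mulr_sumr; apply: eq_bigr => t _.
    by rewrite /E (kummer_eltE _ t) mulrCA.
  rewrite aE bE -sumrB -big_split; apply: eq_bigr => i _ /=.
  by rewrite scalerDl scalerBl mulrDr mulrBr.
move=> i t /andP[i_gt0 lt_in] /andP[t_gt0 lt_tm].
have := @kummer_elt_free (fun i => hE i - ha i + hb i) h0 i lt_in.
rewrite aE in Aa; rewrite bE in Bb.
have [q qE] := ringA_components Aa lt_in.
have [N [r [szr rE]]] := ringB_components Bb lt_in.
move=> /(congr1 (fun h => h%:A * x ^+ N : K)).
rewrite scalerDl scalerBl qE rE hEE scale0r mul0r.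
have le_mN : (m i <= N.+1)%N by apply: leq_trans szr; apply: leq_addl.
rewrite mulrDl divfK // mulrBl mulr_suml.
have -> : \sum_(1 <= w < m i) cstK K (c i w) / x ^+ w * x ^+ N =
    polyK K (\sum_(1 <= w < m i) c i w *: 'X^(N - w)).
  rewrite rmorph_sum big_nat [RHS]big_nat; apply: eq_bigr => w /andP[_ lt_wm] /=.
  have le_wN : (w <= N)%N by rewrite -ltnS (leq_trans lt_wm).
  rewrite -mul_polyC rmorphM rmorphXn -mulrA; congr (_ * _).
  by rewrite -{1}(subnK le_wN) exprD mulrCA mulVf ?mulr1.
rewrite -rmorphXn -rmorphM -rmorphB -rmorphD => /eqP; rewrite polyK_eq0 => /eqP.
move=> /(congr1 (fun p : {poly k} => p`_(N - t))).
have le_tN : (t <= N)%N by rewrite -ltnS (leq_trans lt_tm).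
rewrite coefD coefB coef0 coefMXn ltn_subrL t_gt0 (leq_trans t_gt0 le_tN) subr0.
rewrite [r`_ _]nth_default ?addr0; last first.
  by rewrite leq_subRL // -ltnS (leq_trans _ szr) // addnC ltn_add2l.
rewrite coef_sum (bigD1_seq t) ?iota_uniq ?mem_index_iota ?t_gt0 //=.
rewrite coefZ coefXn eqxx mulr1 big1_seq ?addr0 // => w /andP[ne_wt].
rewrite mem_index_iota => /andP[_ lt_wm].
have le_wN : (w <= N)%N by rewrite -ltnS (leq_trans lt_wm).
rewrite coefZ coefXn; case: eqP => [e|_]; last by rewrite mulr0.
by case/eqP: ne_wt; rewrite -(subKn le_wN) -e subKn.
Qed.

(** * The Frobenius map *)

Lemma p_semilinear_eq p (G1 G2 : H1 K -> H1 K) :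
    p_semilinear p G1 -> p_semilinear p G2 ->
    (forall i t, (1 <= i < n)%N -> (1 <= t < m i)%N ->
       G1 (kummer_class n fs y i t) = G2 (kummer_class n fs y i t)) ->
  G1 =1 G2.
Proof.
move=> [add1 scale1] [add2 scale2] eqG h.
have zero (H : H1 K -> H1 K) : {morph H : h1 h2 / h1 + h2} -> H 0 = 0.
  by move=> addH; apply: (addrI (H 0)); rewrite -addH !addr0.
have [c ->] := kummer_class_span h.
rewrite (big_morph G1 add1 (zero _ add1)) (big_morph G2 add2 (zero _ add2)).
apply: eq_big_nat => i lt_in.
rewrite (big_morph G1 add1 (zero _ add1)) (big_morph G2 add2 (zero _ add2)).
by apply: eq_big_nat => t lt_tm; rewrite scale1 scale2 eqG.
Qed.

(** The subtraction of natural numbers in the exponent is exact, because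
    floor(j p i / n) = j floor(p i / n) + floor(j (p i mod n) / n) is at least
    p floor(j i / n). *)
Definition frobenius_prefactor p i : {poly k} :=
  u ^+ (p * i %/ n) *: \prod_(1 <= j < n)
    fs j ^+ (j * (p * i %/ n) + j * (p * i %% n) %/ n - p * (j * i %/ n)).

Lemma frobenius_prefactorE p i :
  f ^+ (p * i %/ n) * D (p * i %% n) = frobenius_prefactor p i * D i ^+ p.
Proof.
rewrite /kummer_f exprZn -!scalerAl -!prodrXl -!big_split /=; congr (_ *: _).
apply: eq_bigr => j _; rewrite -!exprM -!exprD [(j * i %/ n * p)%N]mulnC subnK //.
rewrite -divnMDl // -mulnA -mulnDr -divn_eq leq_divRL // -mulnA.
by rewrite [leqRHS]mulnCA leq_mul // leq_divM.
Qed.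

Lemma frobenius_prefactor_frac p i :
  (frobenius_prefactor p i)%:F = f%:F ^+ (p * i %/ n) /
    \prod_(1 <= j < n)
      (fs j)%:F ^ ((p * (j * i %/ n))%N%:Z - (j * (p * i %% n) %/ n)%N%:Z).
Proof.
have -> : \prod_(1 <= j < n)
      (fs j)%:F ^ ((p * (j * i %/ n))%N%:Z - (j * (p * i %% n) %/ n)%N%:Z)
    = (D i ^+ p)%:F / (D (p * i %% n))%:F.
  rewrite -prodrXl !rmorph_prod -prodf_div; apply: eq_big_seq => j rj /=.
  have fj0 : (fs j)%:F != 0 :> F by rewrite tofrac_eq0 kummer_fs_neq0.
  by rewrite expfzDr // -invr_expz -!exprnP -!rmorphXn -exprM [(_ * p)%N]mulnC.
rewrite invf_div mulrA; apply: (canRL (mulfK _)).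
  by rewrite tofrac_eq0 expf_neq0 ?kummer_denom_neq0.
by rewrite -rmorphXn -!rmorphM frobenius_prefactorE.
Qed.

Lemma kummer_elt_frobenius p i t :
  kummer_elt n fs y i t ^+ p =
    g (p * i %% n) * polyK K (frobenius_prefactor p i) / x ^+ (p * t).
Proof.
rewrite (kummer_eltE i t) expr_div_n -exprM [(t * p)%N]mulnC; congr (_ / _).
have Dp0 : polyK K (D i ^+ p) != 0.
  by rewrite polyK_eq0 expf_neq0 ?kummer_denom_neq0.
apply: (mulIf Dp0); rewrite -mulrA -rmorphM -frobenius_prefactorE.
rewrite rmorphM !rmorphXn /= -exprMn [g i * _]mulrC -kummer_yE -exprM.
rewrite mulrCA [g _ * _]mulrC -kummer_yE -(kummer_equation hC) -exprM -exprD.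
by rewrite [(n * _)%N]mulnC -divn_eq mulnC.
Qed.

Lemma frobenius_kummer_formula p : p \in [pchar k] ->
  frobenius_formula n u fs y p (frobenius (K := K) p).
Proof.
move=> kp i lt_in; exists (frobenius_prefactor p i).
  exact: frobenius_prefactor_frac.
move=> t _; rewrite /kummer_class frobenius_class //; last first.
  exact: kummer_elt_overlap hC.
by rewrite kummer_elt_frobenius H1_class_laurent.
Qed.

Lemma frobenius_kummer_unique p (G' : H1 K -> H1 K) : p \in [pchar k] ->
    p_semilinear p G' -> frobenius_formula n u fs y p G' ->
  G' =1 frobenius (K := K) p.
Proof.
move=> kp linG formG; apply: (p_semilinear_eq linG (frobenius_semilinear K kp)).
move=> i t lt_in lt_tm.
have [q1 q1E ->] // := formG i lt_in.
have [q2 q2E ->] // := frobenius_kummer_formula kp lt_in.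
by have /eqP -> : q1 == q2 by rewrite -tofrac_eq q1E q2E.
Qed.

(** * The genus *)

(** If m_i = 0 then G_i is a constant, so g_i is algebraic over k, hence in k; but
    g_i and g_0 = 1 are independent over k(x). *)
Lemma kummer_m_gt0 i : full_constant_field K -> (1 <= i < n)%N -> (0 < m i)%N.
Proof.
move=> cst_closed /andP[i_gt0 lt_in]; rewrite ltnNge kummer_m_le muln0 leqn0.
apply/negP => /eqP G_cst.
have [a GE] : exists a, G i = a%:P.
  exists (G i)`_0; apply: size1_polyC.
  by rewrite (polySpred (kummer_norm_neq0 i)) -/(pdeg _) G_cst.
have [c gE] : exists c, g i = cstK K c.
  apply: cst_closed; apply/integral_algebraic.
  by apply: integral_root_exp n_gt0 _; rewrite kummer_elt0_exp GE.
have g0 : g 0 = 1.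
  rewrite kummer_elt0E expr0 div1r /kummer_denom big1 ?rmorph1 ?invr1 // => j _.
  by rewrite muln0 div0n.
(* The coordinates of the vanishing element g_i - c g_0. *)
pose h j : F := (j == i)%:R - (j == 0%N)%:R * (c%:P)%:F.
have : h i = 0.
  apply: kummer_elt_free (lt_in).
  rewrite (bigD1 (Ordinal lt_in)) //= (bigD1 (Ordinal n_gt0)) /=; last first.
    by rewrite -val_eqE /= ltn_eqF.
  rewrite big1 => [|j /andP[/negPf ne_ji /negPf ne_j0]]; last first.
    rewrite /h -!val_eqE /= in ne_ji ne_j0 *.
    by rewrite ne_ji ne_j0 mul0r subr0 scale0r mulr0.
  rewrite addr0 /h eqxx (gtn_eqF i_gt0) (ltn_eqF i_gt0) eqxx g0 gE.
  by rewrite mul0r subr0 sub0r !mul1r scale1r mulr1 scaleNr subrr.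
by rewrite /h eqxx (gtn_eqF i_gt0) mul0r subr0 => /eqP; rewrite oner_eq0.
Qed.

(** For each j, (ji mod n) + (j(n-i) mod n) is 0 or n.  Hence the degrees of G_i and
    of G_(n-i) add up to n e with e at most the sum of the deg f_j, and two
    fractions with denominator n and integral sum e round up to at most e + 1
    together. *)
Lemma kummer_m_rev i : (1 <= i < n)%N ->
  (m i + m (n - i) <= (\sum_(1 <= j < n) pdeg (fs j)).+1)%N.
Proof.
move=> /andP[i_gt0 lt_in].
pose b j := ((j * i %% n + j * (n - i) %% n) %/ n)%N.
have bE j : (j * i %% n + j * (n - i) %% n = n * b j)%N.
  rewrite [RHS]mulnC divnK // /dvdn modnDm -mulnDr subnKC ?(ltnW lt_in) //.
  exact/eqP/modnMl.
have b_le1 j : (b j <= 1)%N.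
  rewrite -ltnS -(ltn_pmul2l n_gt0) -bE muln2 -addnn.
  by rewrite -addnS leq_add ?ltn_pmod // ltnW ?ltn_pmod.
set e := (\sum_(1 <= j < n) pdeg (fs j) * b j)%N.
have le_e : (e <= \sum_(1 <= j < n) pdeg (fs j))%N.
  by apply: leq_sum => j _; rewrite -[leqRHS]muln1 leq_mul.
have GE : (pdeg (G i) + pdeg (G (n - i)) = n * e)%N.
  rewrite !pdeg_kummer_norm -big_split big_distrr; apply: eq_bigr => j _ /=.
  by rewrite -mulnDr bE mulnCA.
apply: (@leq_trans e.+1) => //.
case mE: (m i) => [|M].
  rewrite add0n leqW // kummer_m_le -GE; exact: leq_addl.
have lt_G : (n * M < pdeg (G i))%N by rewrite ltnNge -kummer_m_le mE ltnn.
have le_Me : (M <= e)%N.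
  by rewrite -(leq_pmul2l n_gt0) -GE (leq_trans (ltnW lt_G)) ?leq_addr.
rewrite addSn ltnS -leq_subRL // kummer_m_le mulnBr -GE.
rewrite leq_subRL; last by rewrite (leq_trans (ltnW lt_G)) ?leq_addr.
by rewrite leq_add2r ltnW.
Qed.

(** The bound is the sum of [kummer_m_rev] over all i, in which each m_i occurs
    twice. *)
Lemma kummer_genus : full_constant_field K -> exists g : nat,
  [/\ is_genus K g,
      g%:Z = (\sum_(1 <= i < n) kummer_m n u fs i) - n%:Z + 1
    & 0 <= g%:R :> rat
      /\ g%:R <= 1 / 2%:R * (n%:R - 1) * ((pdeg f)%:R - 1) :> rat].
Proof.
move=> cst_closed.
pose s := [seq (i, t) | i <- index_iota 1 n, t <- index_iota 1 (m i)].
have szs : (size s + n.-1 = \sum_(1 <= i < n) m i)%N.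
  rewrite size_allpairs_dep sumnE big_map -[n.-1]subn1 -[(n - 1)%N]muln1.
  rewrite -sum_nat_const_nat -big_split; apply: eq_big_nat => i lt_in /=.
  by rewrite size_iota subnK // kummer_m_gt0.
exists (size s); split.
- apply: (@vector_axiom_basis _ _ _ _ (fun a => kummer_class n fs y a.1 a.2)).
  + by apply: allpairs_uniq_dep => [|i _|[i t] [j t'] _ _ /= [-> ->]//];
      apply: iota_uniq.
  + move=> h; have [c ->] := kummer_class_span h; exists (fun a => c a.1 a.2).
    by rewrite big_allpairs_dep.
  + move=> c; rewrite big_allpairs_dep /= => c0 _ /allpairsPdep[i [t [ri rt ->]]].
    rewrite !mem_index_iota in ri rt.
    exact: (@kummer_class_free (fun i t => c (i, t))) c0 i t ri rt.
- have -> : \sum_(1 <= i < n) kummer_m n u fs i = (size s + n.-1)%:Z.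
    rewrite szs -[RHS]natz natr_sum; apply: eq_bigr => i _.
    by rewrite natz gez0_abs ?(kummer_m_ge0 _ hC).
  have -> : n%:Z = n.-1%:Z + 1 by rewrite -PoszD addn1 prednK.
  by rewrite PoszD opprD addrA !addrK.
split; first exact: ler0n.
have le_2g : (size s * 2 + n.-1 <= n.-1 * pdeg f)%N.
  have le_2m : (\sum_(1 <= i < n) (m i + m (n - i)) <=
      n.-1 * (\sum_(1 <= j < n) pdeg (fs j)).+1)%N.
    rewrite -subn1 -sum_nat_const_nat big_nat [leqRHS]big_nat.
    by apply: leq_sum => i; apply: kummer_m_rev.
  have le_d : (\sum_(1 <= j < n) pdeg (fs j) <= pdeg f)%N.
    rewrite (pdeg_kummer_f hC) big_nat [leqRHS]big_nat.
    by apply: leq_sum => j /andP[j0 _]; rewrite leq_pmull.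
  rewrite -(leq_add2r n.-1) -addnA addnn -muln2 -mulnDl szs.
  rewrite -mulnSr (leq_trans _ (leq_trans le_2m _)) ?leq_mul ?ltnS //.
  rewrite big_split /= muln2 -addnn leq_add2l.
  rewrite big_nat_rev; under eq_bigr do rewrite add1n subSS; exact: leqnn.
have -> : n%:R - 1 = (n.-1)%:R :> rat by rewrite -{1}(prednK n_gt0) -natr1 addrK.
rewrite mul1r -mulrA ler_pdivlMl ?ltr0n // mulrBr mulr1.
by rewrite lerBrDr -!natrM -natrD ler_nat [(2 * _)%N]mulnC.
Qed.

End KummerCover.

Theorem lemma3 (k : fieldType) (n : nat) (u : k) (fs : nat -> {poly k})
    (K : fieldExtType {fraction {poly k}}) (y : K)
    (hC : kummer_cover n u fs y) :
  let f := kummer_f n u fs in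
  let m := kummer_m n u fs in
  let e := kummer_class n fs y in
  [/\ (* (1) the classes e i t form a k-basis of H^1(C, O_C) *)
      (forall h : H1 K, exists c : nat -> nat -> k,
          h = \sum_(1 <= i < n) \sum_(1 <= t < `|m i|%N) c i t *: e i t)
      /\ (forall c : nat -> nat -> k,
          \sum_(1 <= i < n) \sum_(1 <= t < `|m i|%N) c i t *: e i t = 0 ->
          forall i t, (1 <= i < n)%N -> (1 <= t < `|m i|)%N -> c i t = 0),
      (* (2) genus *)
      full_constant_field K ->
        exists g : nat,
          [/\ is_genus K g,
              g%:Z = (\sum_(1 <= i < n) m i) - n%:Z + 1
            & 0 <= g%:R :> rat
              /\ g%:R <= 1 / 2%:R * (n%:R - 1) * ((pdeg f)%:R - 1) :> rat]
    & (* (3) Frobenius *)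
      forall p : nat, p \in [pchar k] ->
        [/\ p_semilinear p (frobenius (K := K) p),
            frobenius_formula n u fs y p (frobenius (K := K) p)
          & forall G : H1 K -> H1 K, p_semilinear p G ->
              frobenius_formula n u fs y p G -> G =1 frobenius (K := K) p]].
Proof.
move=> f m e; split; first by split;
  [exact: kummer_class_span hC | exact: kummer_class_free hC].
- exact: kummer_genus hC.
move=> p kp; split; first exact: frobenius_semilinear.
- exact: (frobenius_kummer_formula hC).
- by move=> G; apply: (frobenius_kummer_unique hC).
Qed.
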